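(* Let $p>3$ be a prime. Then $$\sum_{k=0}^{(p-1)/2}\frac{\binom{3k}k\binom{6k}{3k}}{432^k}\equiv(-1)^{\frac{p-1}2}\Big(1+\Big(\frac 3p\Big)S_{p-(\frac 3p)}\Big)\pmod{p^2}.$$
   Context: $\big(\frac 3p\big)$ is the Legendre symbol. The sequence $\{S_n\}$ is defined by $S_0=0$, $S_1=1$, $S_{n+1}=4S_n-S_{n-1}$ for $n\ge1$. Congruences are in the ring of rationals with denominators prime to $p$. *)

(* Defs.v *)
From mathcomp Require Import all_boot all_order all_algebra.
Set Implicit Arguments.
Unset Strict Implicit.
Unset Printing Implicit Defensive.
Import Order.TTheory GRing.Theory Num.Theory.
Local Open Scope ring_scope.

(* The Legendre symbol (a / p), meaningful for p an odd prime. *)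
Definition legendre (a : int) (p : nat) : int :=
  if (p %| a)%Z then 0
  else if [exists x : 'I_p, (x%:Z ^+ 2 == a %[mod p])%Z] then 1
  else -1.

Fixpoint S_ (n : nat) : int :=
  match n with
  | 0 => 0
  | n1.+1 => match n1 with
             | 0 => 1
             | n2.+1 => 4 * S_ n1 - S_ n2
             end
  end.

(* Membership in the ring of rationals with denominator prime to p;
   denq x is the denominator of x in lowest terms. *)
Definition prat (p : nat) : pred rat := fun x => coprime p `|denq x|%N.

(* Congruence modulo m in the ring prat p: both sides lie in the ring and
   their difference lies in the ideal generated by m. *)
Definition prat_congr (p m : nat) (x y : rat) : Prop :=
  [/\ prat p x, prat p y & exists2 z : rat, prat p z & x - y = m%:R * z].

(* Main.v *)
Require Import Defs.
From HB Require Import structures.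
From mathcomp Require Import all_boot all_order all_algebra.
From mathcomp Require Import finfield.
From mathcomp Require Import ring zify.
Import Order.TTheory GRing.Theory Num.Theory.
Local Open Scope ring_scope.

(* Let p = 2n + 1, t = floor (p / 6).  The summand is C(a,k) C(-1-a,k) with
   a = -1/6, and up to the symmetry a <-> -1-a one has a = t - p/6.
   The truncated sums F(x) = sum_{k <= n} C(x,k) C(-1-x,k) satisfy
   F(x) + F(x-1) = 2 R(x), where R(x) = prod_{1 <= i <= n} (1 - x^2/i^2).
   Descending from t - p/6 to -p/6 and working modulo p^2 one finds
   F(a) = (-1)^t (1 + (p/6) (H_n - 2 sum_{s <= t} (-1)^s/s)).
   Since C(p,k) = (-1)^(k-1) p/k modulo p^2, p times the harmonic part is
   2 - 2^p + 24 sum_{k = 2p mod 12} C(p,k).  The last sum is evaluated by a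
   discrete Fourier transform modulo 24, in integer form: sums
   sum_k C(p,k) g(2k-p) for 24-periodic even functions g which are
   eigenfunctions of g |-> g(j+2) + 2 g(j) + g(j-2) produce 2^p, 2^n, 3^n and
   S_{n+1} +- S_n; the same sums, taken modulo p, give these numbers modulo p
   in terms of (2/p) and (3/p). *)

(** * Rationals with denominator prime to p, and powers of the ideal of p *)

Lemma prat_intro (p d : nat) (z : int) (x : rat) :
  coprime p d -> d%:R * x = z%:~R -> x \in prat p.
Proof.
move=> cpd dx; rewrite unfold_in /prat.
apply: coprime_dvdr cpd.
have e : (d%:Z * numq x = z * denq x)%R.
  by apply/eqP; rewrite -(eqr_int rat) !rmorphM /= -dx numqE mulrA.
have : (`|denq x| %| d * `|numq x|)%N.
  by rewrite -[d]/(`|d%:Z|%N) -abszM e abszM dvdn_mull.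
by rewrite Gauss_dvdl // coprime_sym coprime_num_den.
Qed.

Lemma prat_elim (p : nat) (x : rat) :
  x \in prat p -> exists2 d : nat, coprime p d & d%:R * x = (numq x)%:~R.
Proof.
rewrite unfold_in /prat => cp; exists `|denq x|%N => //.
by rewrite -[_%:R]/((`|denq x|%N : int)%:~R) absz_denq mulrC -numqE.
Qed.

Lemma prat_subring (p : nat) : subring_closed (prat p).
Proof.
split=> [|x y /prat_elim[d cd ed] /prat_elim[e ce ee]|x y /prat_elim[d cd ed] /prat_elim[e ce ee]].
- by apply: (@prat_intro _ 1 1); rewrite ?coprimen1 ?mulr1.
- apply: (@prat_intro _ (d * e)%N (numq x * e%:Z - numq y * d%:Z)).
    by rewrite coprimeMr cd.
  by rewrite natrM rmorphB !rmorphM /= -ed -ee; ring.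
- apply: (@prat_intro _ (d * e)%N (numq x * numq y)).
    by rewrite coprimeMr cd.
  by rewrite natrM rmorphM /= -ed -ee; ring.
Qed.

HB.instance Definition _ (p : nat) :=
  GRing.isSubringClosed.Build rat (prat p) (prat_subring p).

Lemma prat_natV (p d : nat) : coprime p d -> (d%:R)^-1 \in prat p.
Proof.
move=> c; have [->|d0] := eqVneq d 0%N; first by rewrite invr0 rpred0.
by apply: (@prat_intro _ d 1) => //; rewrite mulfV // pnatr_eq0.
Qed.

Lemma prat_nat_div (p k d : nat) : coprime p d -> k%:R / d%:R \in prat p.
Proof. by move=> c; rewrite rpredM ?rpred_nat ?prat_natV. Qed.

(** Stated by division, so that membership directly provides the cofactor that [prat_congr] asks
    for. *)
Definition pideal (p k : nat) : pred rat := fun x => x / p%:R ^+ k \in prat p.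

Lemma pidealE (p k : nat) (x : rat) :
  (x \in pideal p k) = (x / p%:R ^+ k \in prat p).
Proof. by []. Qed.

Lemma pideal_zmod (p k : nat) : zmod_closed (pideal p k).
Proof.
split=> [|x y]; rewrite !pidealE; first by rewrite mul0r rpred0.
by move=> px py; rewrite mulrBl rpredB.
Qed.

HB.instance Definition _ (p k : nat) :=
  GRing.isZmodClosed.Build rat (pideal p k) (pideal_zmod p k).

Lemma pideal0 (p : nat) (x : rat) : (x \in pideal p 0) = (x \in prat p).
Proof. by rewrite pidealE divr1. Qed.

Lemma pidealM (p i j : nat) (x y : rat) :
  x \in pideal p i -> y \in pideal p j -> x * y \in pideal p (i + j).
Proof. by rewrite !pidealE exprD invfM mulrACA => px py; rewrite rpredM. Qed.

Lemma pidealMl (p k : nat) (x y : rat) :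
  x \in prat p -> y \in pideal p k -> x * y \in pideal p k.
Proof. by rewrite -pideal0 => px py; apply: (pidealM _ 0). Qed.

Lemma pidealMr (p k : nat) (x y : rat) :
  x \in pideal p k -> y \in prat p -> x * y \in pideal p k.
Proof. by move=> px py; rewrite mulrC pidealMl. Qed.

Lemma pideal_p (p : nat) : (0 < p)%N -> p%:R \in pideal p 1.
Proof. by move=> p0; rewrite pidealE divff ?rpred1 // pnatr_eq0 -lt0n. Qed.

Lemma pidealW (p k : nat) (x : rat) : (0 < p)%N ->
  x \in pideal p k.+1 -> x \in pideal p k.
Proof.
move=> p0; rewrite !pidealE => px.
have -> : x / p%:R ^+ k = p%:R * (x / p%:R ^+ k.+1).
  by rewrite exprS; field; rewrite ?expf_neq0 //= pnatr_eq0 -lt0n.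
by rewrite rpredM // rpred_nat.
Qed.

Lemma pideal_int (p : nat) (z : int) : (0 < p)%N ->
  (p%:Z %| z)%Z -> z%:~R \in pideal p 1.
Proof.
move=> p0 /dvdzP[q ->]; rewrite rmorphM /=.
by apply: pidealMl; [rewrite rpred_int | apply: pideal_p].
Qed.

(** A factor b that is 1 modulo p moves a target u of order p^k only by [u * (b - 1)], of order
    p^(k+1). *)
Lemma pideal_mul_near1 (p k : nat) (a b u : rat) : 
  u \in pideal p k -> b - 1 \in pideal p 1 -> (0 < p)%N ->
  a - u \in pideal p k.+1 -> a * b - u \in pideal p k.+1.
Proof.
move=> pu pb p0 pa.
have -> : a * b - u = (a - u) * b + u * (b - 1) by ring.
rewrite rpredD //; last by rewrite -addn1 pidealM.
apply: pidealMr => //.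
by rewrite -[b](subrK 1) rpredD ?rpred1 // -pideal0 pidealW.
Qed.

(** * The truncated hypergeometric sum and its recurrences *)

Definition hyp_sum (n : nat) (x : rat) : rat :=
  \sum_(0 <= k < n.+1)
     \prod_(0 <= i < k) ((x - i%:R) * (-1 - x - i%:R) / i.+1%:R ^+ 2).

(** A partial Euler product of sin(pi x) / (pi x). *)
Definition sin_prod (n : nat) (x : rat) : rat :=
  \prod_(0 <= i < n) (1 - x ^+ 2 / i.+1%:R ^+ 2).

Lemma natS_neq0 (n : nat) : n%:R + 1 != 0 :> rat.
Proof. by rewrite natr1 pnatr_eq0. Qed.

(** Term k+1 of either sum is [sin_prod k x] times an elementary factor; the two factors add up to
    -2 x^2 / (k+1)^2, so the combined terms telescope to increments of [2 * sin_prod]. *)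
Lemma hyp_sum_step (n : nat) (x : rat) :
  hyp_sum n x + hyp_sum n (x - 1) = 2 * sin_prod n x.
Proof.
have shift k : \prod_(0 <= i < k.+1) ((x - i%:R) * (-1 - x - i%:R) / i.+1%:R ^+ 2)
    = sin_prod k x * (x * (- x - k.+1%:R) / k.+1%:R ^+ 2).
  elim: k => [|k IH]; first by rewrite /sin_prod !big_nat1 big_nil; field.
  rewrite big_nat_recr //= IH /sin_prod [in RHS]big_nat_recr //= -!mulrA.
  by congr (_ * _); rewrite -!natr1; field; rewrite !natr1 !pnatr_eq0.
have shift' k : \prod_(0 <= i < k.+1) ((x - 1 - i%:R) * (-1 - (x - 1) - i%:R) / i.+1%:R ^+ 2)
    = sin_prod k x * (- x * (x - k.+1%:R) / k.+1%:R ^+ 2).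
  elim: k => [|k IH]; first by rewrite /sin_prod !big_nat1 big_nil; field.
  rewrite big_nat_recr //= IH /sin_prod [in RHS]big_nat_recr //= -!mulrA.
  by congr (_ * _); rewrite -!natr1; field; rewrite !natr1 !pnatr_eq0.
elim: n => [|n IH].
  by rewrite /hyp_sum /sin_prod !big_nat1 !big_nil mulr1.
rewrite /hyp_sum !(big_nat_recr n.+1) //= shift shift' addrACA.
rewrite -!/(hyp_sum _ _) IH /sin_prod [in RHS]big_nat_recr //= -!/(sin_prod _ _).
by rewrite -natr1; field; rewrite nat1r pnatr_eq0.
Qed.

(** Replacing x by x + 1 shifts the factors i - x and i + x by one index, so only end factors
    survive; the cross-multiplied form needs no condition on x. *)
Lemma sin_prod_shift (n : nat) (x : rat) :
  (x + 1) * (n%:R - x) * sin_prod n (x + 1)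
  = - (x * (n%:R + 1 + x)) * sin_prod n x.
Proof.
elim: n => [|n IH]; first by rewrite /sin_prod !big_nil; ring.
have N0 := natS_neq0 n.
have recr y : sin_prod n.+1 y
    = sin_prod n y * ((n%:R + 1 - y) * (n%:R + 1 + y)) / (n%:R + 1) ^+ 2.
  rewrite /sin_prod big_nat_recr //= -natr1 -mulrA; congr (_ * _); field.
  exact: N0.
rewrite !recr -natr1.
have -> : (x + 1) * (n%:R + 1 - x) * (sin_prod n (x + 1) *
    ((n%:R + 1 - (x + 1)) * (n%:R + 1 + (x + 1))) / (n%:R + 1) ^+ 2) =
  ((x + 1) * (n%:R - x) * sin_prod n (x + 1)) *
    ((n%:R + 1 - x) * (n%:R + 1 + (x + 1))) / (n%:R + 1) ^+ 2.
  by field; exact: N0.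
by rewrite IH; field; exact: N0.
Qed.

(** For u in the ideal of p and indices below p, the multipliers are 1 modulo p. *)
Lemma hyp_term_step (m : nat) (u : rat) :
  let c k := \prod_(0 <= i < k)
               ((- u - i%:R) * (-1 - - u - i%:R) / i.+1%:R ^+ 2) in
  c m.+2 * m.+2%:R = c m.+1 * m.+1%:R * ((1 + u / m.+1%:R) * (1 - u / m.+2%:R)).
Proof.
move=> c; rewrite {1}/c big_nat_recr //= -/(c _) -!mulrA; congr (_ * _).
by rewrite -!natr1; field; rewrite !natr1 !pnatr_eq0.
Qed.

(** The numerator is (6k)! / ((3k)! (2k)! k!), and both sides have the same ratio of consecutive
    terms: 432 = 12 * 36, with 12 from the factorials and 36 from clearing the sixths. *)
Lemma binom_term (k : nat) :
  ('C(3 * k, k) * 'C(6 * k, 3 * k))%:R / 432%:R ^+ k =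
  \prod_(0 <= i < k)
     ((-1 / 6%:R - i%:R) * (-1 - -1 / 6%:R - i%:R) / i.+1%:R ^+ 2) :> rat.
Proof.
pose B j : rat := ('C(3 * j, j) * 'C(6 * j, 3 * j))%:R.
have BE j : B j * ((3 * j)`! * (2 * j)`! * j`!)%:R = ((6 * j)`!)%:R.
  rewrite -natrM; congr _%:R.
  have := @bin_fact (3 * j) j; have := @bin_fact (6 * j) (3 * j).
  have -> : (6 * j - 3 * j = 3 * j)%N by lia.
  have -> : (3 * j - j = 2 * j)%N by lia.
  by move=> <- //; [move=> <- //; [nia|lia]|lia].
have rec j : B j.+1 * (j%:R + 1) ^+ 2 = 12 * (6 * j%:R + 1) * (6 * j%:R + 5) * B j.
  pose f : rat := ((3 * j)`! * (2 * j)`! * j`!)%:R.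
  have f0 : f != 0 by rewrite pnatr_eq0 -lt0n !muln_gt0 !fact_gt0.
  have := BE j.+1; have := BE j; rewrite -/f.
  have -> : (3 * j.+1 = (3 * j).+3)%N by lia.
  have -> : (2 * j.+1 = (2 * j).+2)%N by lia.
  have -> : (6 * j.+1 = (6 * j).+4.+2)%N by lia.
  move=> e1; rewrite !factS !natrM -e1 -!natr1 !natrM => e2.
  have J : [/\ 3 * j%:R + 3 != 0 :> rat, 3 * j%:R + 2 != 0 :> rat, 3 * j%:R + 1 != 0 :> rat,
      2 * j%:R + 1 != 0 :> rat & j%:R + 1 != 0 :> rat].
    by split; rewrite -?natrM ?natr1 -?natrD pnatr_eq0 ?addnS.
  case: J => J3 J32 J31 J2 J1.
  (* [g * (j + 1) ^ 2] is the factorial denominator at j + 1. *)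
  pose g : rat := f * (3 * j%:R + 3) * (3 * j%:R + 2) * (3 * j%:R + 1) * (2 * j%:R + 1) * 2.
  have g0 : g != 0 by rewrite !mulf_neq0.
  apply: (mulIf g0); rewrite /g /f !natrM.
  transitivity ((B j.+1 * ((3 * j%:R + 1 + 1 + 1) * ((3 * j%:R + 1 + 1) * ((3 * j%:R + 1) * ((3 * j)`!)%:R))
     * ((2 * j%:R + 1 + 1) * ((2 * j%:R + 1) * ((2 * j)`!)%:R)) * ((j%:R + 1) * (j`!)%:R)))).
    by ring.
  by rewrite e2 /f !natrM; ring.
have E432 : 432%:R = 12 * 36 :> rat by rewrite -natrM.
have D0 : 432%:R != 0 :> rat by rewrite pnatr_eq0.
move: (432%:R) E432 D0 => D ED D0.
elim: k => [|k IH]; first by rewrite big_nil !muln0 bin0 divr1.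
rewrite big_nat_recr //= -IH -/(B _) -/(B _) exprS -natr1.
have J := natS_neq0 k; have KN := expf_neq0 k D0.
move: (_ ^+ k) (B k.+1) (B k) KN (rec k) {IH} => K b1 b0 KN rk.
apply: (mulIf (expf_neq0 2 J)).
transitivity (b1 * (k%:R + 1) ^+ 2 / (12 * 36 * K)).
  by rewrite ED mulrAC.
rewrite rk; field.
by rewrite KN nat1r pnatr_eq0.
Qed.

Lemma hyp_sumC (n : nat) (x : rat) : hyp_sum n (-1 - x) = hyp_sum n x.
Proof.
rewrite /hyp_sum; apply: eq_bigr => k _; apply: eq_bigr => i _.
by congr (_ / _); ring.
Qed.

Lemma binom_sumE (n : nat) :
  \sum_(0 <= k < n.+1) ('C(3 * k, k) * 'C(6 * k, 3 * k))%:R / 432%:R ^+ k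
  = hyp_sum n (-1 / 6%:R).
Proof. by apply: eq_bigr => k _; exact: binom_term. Qed.

(** * Harmonic sums and the value of the hypergeometric sum modulo p^2 *)

Definition harm (n : nat) : rat := \sum_(0 <= j < n) j.+1%:R^-1.
Definition alt_harm (n : nat) : rat := \sum_(0 <= j < n) (-1) ^+ j.+1 / j.+1%:R.

Lemma coprime_lt (p k : nat) : prime p -> (0 < k < p)%N -> coprime p k.
Proof. by move=> pp /andP[k0 kp]; rewrite prime_coprime // gtnNdvd. Qed.

Lemma coprime6_prime (p : nat) : prime p -> (3 < p)%N -> coprime 6 p.
Proof.
by move=> pp p3; rewrite coprime_sym (@coprimeMr p 2 3) !coprime_lt //= (ltn_trans _ p3).
Qed.

Lemma odd_prime (p : nat) : prime p -> (3 < p)%N -> odd p.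
Proof. by move=> pp p3; case: (even_prime pp) => // p2; rewrite p2 in p3. Qed.

Lemma pideal_prod1 (p n : nat) (b : nat -> rat) : (0 < p)%N ->
  (forall i, (i < n)%N -> b i - 1 \in pideal p 1) ->
  \prod_(0 <= i < n) b i - 1 \in pideal p 1.
Proof.
move=> p0; elim: n => [|n IH] bP; first by rewrite big_nil subrr rpred0.
rewrite big_nat_recr //=; apply: pideal_mul_near1 => //; last first.
- by apply: IH => i ilt; apply: bP; apply: ltnW.
- by apply: bP.
by rewrite pideal0 rpred1.
Qed.

(** Each term of index k >= 1, multiplied by k, is u modulo p^2 by [hyp_term_step]. *)
Lemma hyp_sum_at_small (p n : nat) (u : rat) : prime p -> (n < p)%N ->
  u \in pideal p 1 -> hyp_sum n (- u) - (1 + u * harm n) \in pideal p 2.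
Proof.
move=> pp np pu; have p0 := prime_gt0 pp.
rewrite /hyp_sum big_nat_recl //= big_nil.
have := hyp_term_step ^~ u; set c := fun k => _ => /= cS.
rewrite -/c in cS *.
have cP k : (k < n)%N -> c k.+1 * k.+1%:R - u \in pideal p 2.
  elim: k => [|k IH] kn.
    have -> : c 1%N * 1 - u = - (u * u) by rewrite /c big_nat1; field.
    by rewrite rpredN (pidealM _ 1 1).
  rewrite cS; apply: pideal_mul_near1 => //; last by apply: IH; apply: ltnW.
  have I1 : k.+1%:R^-1 \in prat p.
    by apply/prat_natV/coprime_lt => //=; apply: leq_trans np; apply: ltnW.
  have I2 : k.+2%:R^-1 \in prat p.
    by apply/prat_natV/coprime_lt => //=; apply: leq_trans np.
  apply: pideal_mul_near1 => //; first by rewrite pideal0 rpred1.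
    by rewrite addrC addKr rpredN pidealMr.
  by rewrite addrC addKr pidealMr.
have -> : 1 + \sum_(0 <= i < n) c i.+1 - (1 + u * harm n)
   = \sum_(0 <= i < n) (c i.+1 * i.+1%:R - u) / i.+1%:R.
  rewrite /harm mulr_sumr opprD addrACA subrr add0r -sumrB.
  by apply: eq_bigr => i _; field; rewrite nat1r pnatr_eq0.
rewrite big_nat; apply: rpred_sum => i /andP[_ ilt].
apply: pidealMr; first exact: cP.
by apply/prat_natV/coprime_lt => //=; apply: leq_trans np.
Qed.

(* Since [2n + 1 = p], the recurrence factor [(n + 1 + x) / (n - x)] is
   [p / (n - x) - 1], so [x R(x)] is constant modulo [p ^ 2] along
   [x = s - p / 6]. *)
Lemma sin_prod_mod (p n s : nat) : prime p -> (3 < p)%N -> p = (2 * n).+1 ->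
  (s <= n)%N ->
  let x := s%:R - p%:R / 6%:R in
  x * sin_prod n x + p%:R / 6%:R \in pideal p 2.
Proof.
move=> pp p3 pn sn /=; have p0 := prime_gt0 pp.
have c6 : coprime p 6 by rewrite coprime_sym coprime6_prime.
have pu : p%:R / 6%:R \in pideal p 1 by rewrite pidealMr ?pideal_p ?prat_natV.
set u := p%:R / 6%:R in pu *.
elim: s sn => [|s IH] sn.
  rewrite sub0r.
  have -> : - u * sin_prod n (- u) + u = - (u * (sin_prod n (- u) - 1)) by ring.
  rewrite rpredN (pidealM _ 1 1) //; apply: pideal_prod1 => // i ilt.
  rewrite addrC addKr rpredN sqrrN expr2 -mulrA; apply: pidealMr => //.
  apply: rpredM; first by rewrite -pideal0 pidealW.
  by rewrite -natrX prat_natV // coprimeXr ?coprime_lt //=; lia.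
have {}IH := IH (ltnW sn).
have {1}-> : s.+1%:R - u = (s%:R - u) + 1 by rewrite -natr1; ring.
have -> : s.+1%:R - u = (s%:R - u) + 1 by rewrite -natr1; ring.
set x := s%:R - u in IH *.
have nx : n%:R - x = (6 * (n - s) + p)%:R / 6%:R.
  by rewrite natrD natrM natrB 1?ltnW // /x /u; field.
have nx0 : n%:R - x != 0.
  by rewrite nx mulf_neq0 // ?invr_eq0 pnatr_eq0 // addn_eq0 negb_and -!lt0n p0 orbT.
have -> : (x + 1) * sin_prod n (x + 1) = x * sin_prod n x * (1 - p%:R / (n%:R - x)).
  apply: (mulIf nx0); transitivity ((x + 1) * (n%:R - x) * sin_prod n (x + 1)).
    by ring.
  rewrite sin_prod_shift pn -natr1 natrM; field; exact: nx0.
have c6ns : coprime p (6 * (n - s) + p).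
  rewrite -[(_ + p)%N]/((6 * (n - s)) + p)%N /coprime gcdnDr -/(coprime _ _).
  by rewrite coprimeMr c6 coprime_lt //; lia.
rewrite -[u]opprK; apply: pideal_mul_near1; rewrite ?rpredN ?opprK //.
rewrite addrC addKr rpredN; apply: pidealMr; first exact: pideal_p.
by rewrite nx invf_div prat_nat_div.
Qed.

(** Induction on t through [hyp_sum_step]: [sin_prod_mod] gives -(p/6)/t for the product at t - p/6,
    so every step flips the sign and adds one term to [alt_harm]. *)
Lemma hyp_sum_mod (p n t : nat) : prime p -> (3 < p)%N -> p = (2 * n).+1 ->
  (6 * t < p)%N ->
  hyp_sum n (t%:R - p%:R / 6%:R)
    - (-1) ^+ t * (1 + p%:R / 6%:R * (harm n - 2 * alt_harm t))
  \in pideal p 2.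
Proof.
move=> pp p3 pn; have p0 := prime_gt0 pp.
have c6 : coprime p 6 by rewrite coprime_sym coprime6_prime.
have pu : p%:R / 6%:R \in pideal p 1 by rewrite pidealMr ?pideal_p ?prat_natV.
elim: t => [|t IH] tp.
  rewrite expr0 mul1r sub0r /alt_harm big_nil mulr0 subr0.
  by apply: hyp_sum_at_small => //; lia.
have {}IH := IH (ltn_trans (leqnn _) (leq_ltn_trans _ tp)).
have := @sin_prod_mod p n t.+1 pp p3 pn; have := hyp_sum_step n (t.+1%:R - p%:R / 6%:R).
rewrite /=; set u := p%:R / 6%:R in pu IH *.
have -> : t.+1%:R - u - 1 = t%:R - u by rewrite -natr1; ring.
move=> /(canRL (addrK _)) -> Rmod.
have {}Rmod := Rmod _.
set x := t.+1%:R - u in Rmod *.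
(* As [6 * t.+1 < p], the numerator is a positive integer below p, so x is a unit modulo p. *)
have xE : x = - ((p - 6 * t.+1)%:R / 6%:R).
  by rewrite natrB 1?ltnW // natrM /x /u; field.
have x0 : x != 0 by rewrite xE oppr_eq0 mulf_neq0 // pnatr_eq0 subn_eq0 -ltnNge.
have xV : x^-1 \in prat p.
  rewrite xE invrN rpredN invf_div prat_nat_div // coprime_lt //; lia.
have tV : t.+1%:R^-1 \in prat p by rewrite prat_natV // coprime_lt //; lia.
(* Dividing by x instead of [t.+1] costs only u^2 / (x (t+1)), which vanishes modulo p^2. *)
have Rm : sin_prod n x + u / t.+1%:R \in pideal p 2.
  have -> : sin_prod n x + u / t.+1%:R
     = (x * sin_prod n x + u) / x - u * u * (t.+1%:R^-1 * x^-1).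
    have uE : u = t.+1%:R - x by rewrite /x; ring.
    by rewrite uE; field; rewrite x0 nat1r pnatr_eq0.
  apply: rpredB; first by apply: pidealMr => //; apply: Rmod; lia.
  by apply: pidealMr; [rewrite (pidealM _ 1 1) | rewrite rpredM].
have -> : 2 * sin_prod n x - hyp_sum n (t%:R - u)
    - (-1) ^+ t.+1 * (1 + u * (harm n - 2 * alt_harm t.+1)) =
  2 * (sin_prod n x + u / t.+1%:R) - (hyp_sum n (t%:R - u)
    - (-1) ^+ t * (1 + u * (harm n - 2 * alt_harm t))).
  rewrite /alt_harm big_nat_recr //= -!/(alt_harm _) exprS.
  have : (-1) ^+ t * (-1) ^+ t = 1 :> rat by rewrite -expr2 sqrr_sign.
  move: ((-1) ^+ t) => e e1.
  apply/eqP; rewrite -subr_eq0; apply/eqP.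
  transitivity (2 * u / t.+1%:R * (e * e - 1)); first by ring.
  by rewrite e1 subrr mulr0.
apply: rpredB; last by apply: IH; lia.
by apply: pidealMl => //; exact: rpred_nat.
Qed.

(** * Harmonic sums from binomial coefficients modulo p^2 *)

(** The Botez-Catalan identity: twice the even reciprocals up to 2n amount to [harm n]. *)
Lemma alt_harm_double (n : nat) :
  alt_harm (2 * n) = - \sum_(n <= j < 2 * n) j.+1%:R^-1.
Proof.
have tailE m k : (m <= k)%N -> \sum_(m <= j < k) j.+1%:R^-1 = harm k - harm m.
  by move=> mk; rewrite /harm [X in _ = X - _](big_cat_nat _ mk) //= addrAC subrr add0r.
rewrite tailE; last by lia.
elim: n => [|n IH]; first by rewrite /alt_harm /harm !big_nil subrr oppr0.
have -> : (2 * n.+1 = (2 * n).+2)%N by lia.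
rewrite /alt_harm /harm !big_nat_recr //= -!/(alt_harm _) -!/(harm _) IH.
rewrite !exprS mulnC exprM sqrr_sign -!natr1 natrM.
by field; rewrite -natrM !natr1 !pnatr_eq0.
Qed.

(** Used at length [p %/ 6], which is [2 * (p %/ 12)] or one more. *)
Lemma alt_harm_half (n e : nat) : (e <= 1)%N ->
  alt_harm (2 * n + e) = - \sum_(n <= j < 2 * n + e) j.+1%:R^-1.
Proof.
case: e => [_|[_|//]]; first by rewrite addn0 alt_harm_double.
rewrite addn1 /alt_harm !big_nat_recr /=; try lia.
by rewrite -/(alt_harm _) alt_harm_double exprS mulnC exprM sqrr_sign opprD; congr (_ + _); ring.
Qed.

(** C(p, k+1) = p/(k+1) C(p-1, k), and C(p-1, k) is (-1)^k modulo p by Pascal's rule, as p divides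
    the inner C(p, j). *)
Lemma bin_prime_mod (p k : nat) : prime p -> (k.+1 < p)%N ->
  ('C(p, k.+1))%:R - (-1) ^+ k * p%:R / k.+1%:R \in pideal p 2.
Proof.
move=> pp kp; have p0 := prime_gt0 pp.
have K j : (j < p)%N -> ('C(p.-1, j))%:R - (-1) ^+ j \in pideal p 1.
  elim: j => [|j IH] jp; first by rewrite bin0 subrr rpred0.
  have e : ('C(p, j.+1) = 'C(p.-1, j.+1) + 'C(p.-1, j))%N.
    by rewrite -{1}(prednK p0) binS.
  have -> : ('C(p.-1, j.+1))%:R - (-1) ^+ j.+1
      = ('C(p, j.+1))%:R - (('C(p.-1, j))%:R - (-1) ^+ j) :> rat.
    by rewrite e natrD exprS; ring.
  apply: rpredB; last by apply: IH; apply: ltnW.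
  have /dvdnP[q ->] := prime_dvd_bin pp (k := j.+1) jp.
  by rewrite natrM pidealMl ?rpred_nat ?pideal_p.
have e : ('C(p, k.+1))%:R = p%:R / k.+1%:R * ('C(p.-1, k))%:R :> rat.
  have := mul_bin_diag p k => /(congr1 (fun x => x%:R : rat)).
  by rewrite !natrM => e; rewrite mulrAC e; field; rewrite nat1r pnatr_eq0.
have -> : ('C(p, k.+1))%:R - (-1) ^+ k * p%:R / k.+1%:R
   = p%:R / k.+1%:R * (('C(p.-1, k))%:R - (-1) ^+ k) :> rat by rewrite e; ring.
apply: (pidealM _ 1 1); last by apply: K; apply: ltnW.
by apply: pidealMr; rewrite ?pideal_p ?prat_natV ?coprime_lt.
Qed.

(** Both terms are compared with [alt_harm (2 * n)]: pairing 1/j with 1/(p-j) relates it to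
    [harm n], and expanding (1+1)^p with [bin_prime_mod] relates it to 2^p. *)
Lemma harm_half_mod (p n : nat) : prime p -> p = (2 * n).+1 ->
  p%:R * harm n - (2 - 2 ^+ p) \in pideal p 2.
Proof.
move=> pp pn; have p0 := prime_gt0 pp.
have h1 : p%:R * (harm n - alt_harm (2 * n)) \in pideal p 2.
  rewrite alt_harm_double opprK.
  have -> : \sum_(n <= j < 2 * n) j.+1%:R^-1 = \sum_(0 <= j < n) (p - j.+1)%:R^-1 :> rat.
    rewrite -{1}[n]add0n big_addn mul2n -addnn addnK big_nat_rev /=.
    by apply: eq_big_nat => j /andP[_ jn]; congr (_%:R^-1); lia.
  rewrite /harm -big_split /= mulr_sumr big_nat; apply: rpred_sum => j /andP[_ jn].
  have jp : (j.+1 < p)%N by lia.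
  have -> : p%:R * (j.+1%:R^-1 + (p - j.+1)%:R^-1) = p%:R * p%:R * (j.+1%:R^-1 * (p - j.+1)%:R^-1) :> rat.
    have -> : p%:R = j.+1%:R + (p - j.+1)%:R :> rat by rewrite -natrD subnKC // ltnW.
    have : j.+1%:R != 0 :> rat by rewrite pnatr_eq0.
    have : (p - j.+1)%:R != 0 :> rat by rewrite pnatr_eq0 -lt0n subn_gt0.
    by move: (j.+1%:R) ((p - j.+1)%:R) => x y y0 x0; field; apply/andP.
  apply: pidealMr; first by rewrite (pidealM _ 1 1) ?pideal_p.
  by apply: rpredM; apply: prat_natV; apply: coprime_lt => //; lia.
have h2 : 2 ^+ p - 2 + p%:R * alt_harm (2 * n) \in pideal p 2.
  have -> : 2 ^+ p - 2 = \sum_(0 <= j < 2 * n) ('C(p, j.+1))%:R :> rat.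
    have := Pascal 1 1 p; rewrite -(big_mkord xpredT (fun i => 'C(p, i) * (1 ^ (p - i) * 1 ^ i))%N).
    rewrite pn big_nat_recl // big_nat_recr //= -pn; under eq_bigr do rewrite !exp1n !muln1.
    rewrite bin0 binn !exp1n !muln1 => e; rewrite -natrX -[2%N]/(1 + 1)%N e !natrD natr_sum.
    by rewrite addrA [1 + _]addrC addrAC -addrA -[1 + 1]/2 addrK.
  rewrite /alt_harm mulr_sumr -big_split /= big_nat; apply: rpred_sum => j /andP[_ jn].
  rewrite exprS (_ : _ + _ = ('C(p, j.+1))%:R - (-1) ^+ j * p%:R / j.+1%:R) ?bin_prime_mod //; last by ring.
  lia.
have -> : p%:R * harm n - (2 - 2 ^+ p) = p%:R * (harm n - alt_harm (2 * n))
   + (2 ^+ p - 2 + p%:R * alt_harm (2 * n)) :> rat by ring.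
exact: rpredD.
Qed.

(** The upper bound is the ceiling of (N - r) / d; as r <= d - 1, the truncated subtraction is
    exact. *)
Lemma sum_residue (V : nmodType) (f : nat -> V) (d r N : nat) : (r < d)%N ->
  \sum_(0 <= k < N | (k %% d == r)%N) f k
  = \sum_(0 <= i < ((N + d.-1 - r) %/ d)%N) f (d * i + r)%N.
Proof.
move=> rd; have d0 : (0 < d)%N by apply: leq_ltn_trans rd.
elim: N => [|N IH].
  by rewrite big_nil divn_small ?big_nil //; lia.
rewrite big_mkcond big_nat_recr //= -big_mkcond /= IH.
move: (N %/ d)%N (N %% d)%N (divn_eq N d) (ltn_pmod N d0) => q m NE md  {IH}.
have quot a b : (b < d)%N -> ((a * d + b) %/ d = a)%N.
  by move=> bd; rewrite divnMDl // divn_small ?addn0.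
case: (ltngtP m r) => mr.
- have -> : (N + d.-1 - r = q * d + (m + d.-1 - r))%N by lia.
  have -> : (N.+1 + d.-1 - r = q * d + (m + d - r))%N by lia.
  by rewrite !quot ?addr0 //; lia.
- have -> : (N + d.-1 - r = q.+1 * d + (m - r.+1))%N by rewrite mulSn; lia.
  have -> : (N.+1 + d.-1 - r = q.+1 * d + (m - r))%N by rewrite mulSn; lia.
  by rewrite !quot ?addr0 //; lia.
have -> : (N + d.-1 - r = q * d + d.-1)%N by lia.
have -> : (N.+1 + d.-1 - r = q.+1 * d + 0)%N by rewrite mulSn; lia.
by rewrite !quot ?prednK // big_nat_recr //= NE mr mulnC.
Qed.

(** Writing k = 2p - 12s, the range 0 <= k <= p becomes p/12 < s <= p/6; the lower bound is strict
    because 12 does not divide p. *)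
Lemma sum_bin_residue (p : nat) : prime p -> (3 < p)%N ->
  \sum_(0 <= k < p.+1 | (k %% 12 == (2 * p) %% 12)%N) ('C(p, k))%:R
  = \sum_((p %/ 12)%N <= j < (p %/ 6)%N) ('C(p, 2 * p - 12 * j.+1))%:R :> rat.
Proof.
move=> pp p3.
have p12 : (p %% 12 != 0)%N.
  apply/negP => /dvdnP[q pE]; have : (2 %| p)%N by rewrite pE (dvdn_mull _ (n := 12)).
  by rewrite dvdn_prime2 // => /eqP e; rewrite -e in p3.
rewrite sum_residue ?ltn_pmod // -[(p %/ 12)%N]add0n big_addn big_nat_rev /=.
have -> : ((p.+1 + 11 - 2 * p %% 12) %/ 12 = p %/ 6 - p %/ 12)%N by lia.
by apply: eq_big_nat => i /andP[_ ilt]; congr ('C(_, _)%:R); lia.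
Qed.

(** For the even k = 2p - 12s, [bin_prime_mod] gives C(p, k) = -p/k = p/(12s) modulo p^2, and
    [alt_harm_half] collects these reciprocals. *)
Lemma alt_harm_sixth_mod (p : nat) : prime p -> (3 < p)%N ->
  p%:R * alt_harm (p %/ 6)%N
  + 12 * \sum_(0 <= k < p.+1 | (k %% 12 == (2 * p) %% 12)%N) ('C(p, k))%:R
  \in pideal p 2.
Proof.
move=> pp p3; have p0 := prime_gt0 pp.
have odd_p := odd_prime _ pp p3.
rewrite sum_bin_residue //.
have -> : (p %/ 6 = 2 * (p %/ 12) + (p %/ 6 - 2 * (p %/ 12)))%N by lia.
rewrite alt_harm_half; last by lia.
have <- : (p %/ 6 = 2 * (p %/ 12) + (p %/ 6 - 2 * (p %/ 12)))%N by lia.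
rewrite mulrN addrC !mulr_sumr -sumrB big_nat; apply: rpred_sum => j /andP[jc jt].
set k := (2 * p - 12 * j.+1)%N.
have k0 : (0 < k)%N by rewrite /k; lia.
have kp : (k < p)%N by rewrite /k; lia.
have kE : k%:R = 2 * p%:R - 12 * j.+1%:R :> rat by rewrite natrB ?natrM //; lia.
have := @bin_prime_mod p k.-1 pp; rewrite prednK // => /(_ kp).
have -> : (-1) ^+ k.-1 = -1 :> rat.
  by rewrite -signr_odd (_ : odd k.-1) // /k; lia.
move=> bm.
have j0 : j.+1%:R != 0 :> rat by rewrite pnatr_eq0.
have kR0 : k%:R != 0 :> rat by rewrite pnatr_eq0 -lt0n.
(* With s = [j.+1], trading 12/k for -1/s leaves an error 2p/(ks). *)
have -> : 12 * ('C(p, k))%:R - p%:R / j.+1%:R =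
   12 * (('C(p, k))%:R - -1 * p%:R / k%:R) - 2 * (p%:R * p%:R * (k%:R^-1 / j.+1%:R)) :> rat.
  have pE : p%:R = (k%:R + 12 * j.+1%:R) / 2 :> rat by rewrite kE; field.
  rewrite pE; move: (k%:R) kR0 (j.+1%:R) j0 => x x0 y y0; field.
  by rewrite y0.
apply: rpredB; first by apply: pidealMl => //; exact: rpred_nat.
apply: pidealMl; first exact: rpred_nat.
apply: pidealMr; first by rewrite (pidealM _ 1 1) ?pideal_p.
by apply: rpredM; apply: prat_natV; apply: coprime_lt => //; lia.
Qed.

(** * Binomial sums of a function of the centred index *)

(** It adds g over the endpoints of all walks of n steps +1 or -1 from 0; centring turns Pascal's
    rule into the symmetric operator g(j+1) + g(j-1). *)
Definition binsum (n : nat) (g : int -> int) : int :=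
  \sum_(0 <= k < n.+1) ('C(n, k))%:Z * g (2 * k%:Z - n%:Z).

Lemma eq_binsum (n : nat) (f g : int -> int) : f =1 g -> binsum n f = binsum n g.
Proof. by move=> fg; apply: eq_bigr => k _; rewrite fg. Qed.

Lemma binsumS (n : nat) (g : int -> int) :
  binsum n.+1 g = binsum n (fun j => g (j + 1) + g (j - 1)).
Proof.
rewrite /binsum big_nat_recl //= bin0 mul1r.
transitivity (\sum_(0 <= k < n.+1) ('C(n, k))%:Z * g (2 * k%:Z - n%:Z + 1) +
  \sum_(0 <= k < n.+2) ('C(n, k))%:Z * g (2 * k%:Z - n%:Z - 1)); last first.
  rewrite [X in _ + X]big_nat_recr //= bin_small // mul0r addr0 -big_split /=.
  by apply: eq_bigr => k _; rewrite mulrDr.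
rewrite [X in _ = _ + X]big_nat_recl //= bin0 mul1r addrCA -big_split /=.
congr (g _ + _); first by lia.
apply: eq_bigr => k _; rewrite binS PoszD mulrDl addrC.
by congr (_ * g _ + _ * g _); lia.
Qed.

Lemma binsum1 (g : int -> int) : binsum 1 g = g 1 + g (- 1).
Proof. by rewrite /binsum big_nat_recl // big_nat1 /= !bin0 bin1 !mul1r addrC. Qed.

Lemma binsumSS (n : nat) (g : int -> int) :
  binsum n.+2 g = binsum n (fun j => g (j + 2) + 2 * g j + g (j - 2)).
Proof.
rewrite !binsumS; apply: eq_binsum => j.
rewrite addrK subrK (_ : j + 1 + 1 = j + 2); last by ring.
by rewrite (_ : j - 1 - 1 = j - 2); ring.
Qed.

Lemma binsumD (n : nat) (f g : int -> int) :
  binsum n (fun j => f j + g j) = binsum n f + binsum n g.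
Proof. by rewrite -big_split; apply: eq_bigr => k _; rewrite mulrDr. Qed.

Lemma binsumZ (n : nat) (c : int) (g : int -> int) :
  binsum n (fun j => c * g j) = c * binsum n g.
Proof. by rewrite /binsum mulr_sumr; apply: eq_bigr => k _; ring. Qed.

(** Two steps of the walk multiply by c; single steps would bring in the square roots of 2 and 3. *)
Lemma binsum_eigen (c : int) (g : int -> int) (m : nat) :
  (forall j, g (j + 2) + 2 * g j + g (j - 2) = c * g j) ->
  binsum (2 * m).+1 g = c ^+ m * (g 1 + g (- 1)).
Proof.
move=> gc; elim: m => [|m IH]; first by rewrite muln0 binsum1 mul1r.
rewrite (_ : (2 * m.+1).+1 = (2 * m).+3)%N; last by lia.
by rewrite binsumSS (eq_binsum _ _ _ gc) binsumZ IH exprS mulrA.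
Qed.

(** With T the two-step operator, the hypothesis says that T^2 - 4T + 1 kills g, so the sums of odd
    length obey the recurrence of [S_]; lengths 1 and 3 fix the coefficients. *)
Lemma binsum_S_ (g : int -> int) (m : nat) :
  (forall j, g (j + 4) + g (j - 4) = g j) ->
  binsum (2 * m).+1 g
  = binsum 1 g * S_ m.+1 + (binsum 3 g - 4 * binsum 1 g) * S_ m.
Proof.
move=> g4.
have rec n : binsum n.+4 g = 4 * binsum n.+2 g - binsum n g.
  rewrite !binsumSS -[- binsum n g]mulN1r -[4 * binsum _ _]binsumZ -[-1 * binsum _ _]binsumZ -binsumD.
  apply: eq_binsum => j /=.
  rewrite addrK subrK (_ : j + 2 + 2 = j + 4); last by ring.
  rewrite (_ : j - 2 - 2 = j - 4); last by ring.
  apply/eqP; rewrite -subr_eq0; apply/eqP.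
  transitivity (g (j + 4) + g (j - 4) - g j); first by ring.
  by rewrite g4 subrr.
suff : binsum (2 * m).+1 g = binsum 1 g * S_ m.+1 + (binsum 3 g - 4 * binsum 1 g) * S_ m
  /\ binsum (2 * m).+3 g = binsum 1 g * S_ m.+2 + (binsum 3 g - 4 * binsum 1 g) * S_ m.+1.
  by case.
elim: m => [|m [IH1 IH2]]; first by rewrite muln0 /=; split; ring.
rewrite (_ : (2 * m.+1) = (2 * m).+2)%N; last by lia.
split=> //; rewrite rec IH1 IH2.
by rewrite -[S_ m.+3]/(4 * S_ m.+2 - S_ m.+1) -[S_ m.+2]/(4 * S_ m.+1 - S_ m); ring.
Qed.

(** Modulo p only k = 0 and k = p survive. *)
Lemma binsum_prime (p : nat) (g : int -> int) : prime p ->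
  (p%:Z %| binsum p g - (g p%:Z + g (- p%:Z)))%Z.
Proof.
case: p => // p pp; rewrite /binsum big_nat_recl // big_nat_recr //=.
rewrite bin0 binn !mul1r mulr0 sub0r.
rewrite (_ : 2 * p.+1%:Z - p.+1%:Z = p.+1%:Z); last by ring.
rewrite (_ : _ - _ = \sum_(0 <= i < p) ('C(p.+1, i.+1))%:Z * g (2 * i.+1%:Z - p.+1%:Z)); last by ring.
rewrite big_nat; apply: rpred_sum => k /andP[_ kp].
by rewrite dvdz_mulr //= dvdzE /= prime_dvd_bin //; lia.
Qed.

(* The even, 24-periodic function vanishing on even integers and taking the
   given values at 1, 3, 5, 7, 9, 11. *)
Definition tab (a1 a3 a5 a7 a9 a11 : int) (j : int) : int :=
  [:: 0; a1; 0; a3; 0; a5; 0; a7; 0; a9; 0; a11;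
      0; a11; 0; a9; 0; a7; 0; a5; 0; a3; 0; a1]`_`|(j %% 24)%Z|.

(** * Eigenfunctions of period 24 and their binomial sums *)

Lemma tab_mod (a1 a3 a5 a7 a9 a11 x y : int) : (x = y %[mod 24])%Z ->
  tab a1 a3 a5 a7 a9 a11 x = tab a1 a3 a5 a7 a9 a11 y.
Proof. by rewrite /tab => ->. Qed.

(** Turns an identity between 24-periodic functions into a finite computation. *)
Lemma mod24_ind (P : int -> bool) :
  (forall x y, (x = y %[mod 24])%Z -> P x = P y) ->
  all (fun i : nat => P i%:Z) (iota 0 24) -> forall j, P j.
Proof.
move=> Pm /allP Pi j; rewrite (Pm j `|(j %% 24)%Z|%N%:Z).
  by apply: Pi; rewrite mem_iota /=; lia.
by rewrite gez0_abs ?modz_ge0 // modz_mod.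
Qed.

(** On odd j the first four are multiples of cos(aj) for a = 0, pi/3, pi/4, pi/6, with two-step
    eigenvalue 4 cos(a)^2 = 4, 1, 2, 3. [tab24] and [tab24'] are multiples of the difference and the
    sum of cos(pi j/12) and cos(5 pi j/12), whose eigenvalues are the roots of T^2 - 4T + 1. *)
Definition tab_ones := tab 1 1 1 1 1 1.
Definition tab3 := tab 1 (-2) 1 1 (-2) 1.
Definition tab2 := tab 2 (-2) (-2) 2 2 (-2).
Definition tab12 := tab 1 0 (-1) (-1) 0 1.
Definition tab24 := tab 2 4 (-2) 2 (-4) (-2).
Definition tab24' := tab 1 0 1 (-1) 0 (-1).

Ltac tab_dec :=
  let j := fresh "j" in
  move=> j; apply/eqP; move: j; apply: mod24_ind; last (by vm_compute);
  let x := fresh "x" in let y := fresh "y" in let xy := fresh "xy" in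
  move=> x y xy; congr (_ == _); repeat (congr (_ + _) || congr (_ * _));
  apply: tab_mod => //; lia.

Lemma binsum_ones (m : nat) : binsum (2 * m).+1 tab_ones = 2 ^+ (2 * m).+1.
Proof.
rewrite (@binsum_eigen 4); last by rewrite /tab_ones; tab_dec.
by rewrite exprS mulrC exprM.
Qed.

Lemma binsum_tab3 (m : nat) : binsum (2 * m).+1 tab3 = 2.
Proof.
rewrite (@binsum_eigen 1); last by rewrite /tab3; tab_dec.
by rewrite expr1n.
Qed.

Lemma binsum_tab2 (m : nat) : binsum (2 * m).+1 tab2 = 4 * 2 ^+ m.
Proof. by rewrite (@binsum_eigen 2) 1?mulrC //; rewrite /tab2; tab_dec. Qed.

Lemma binsum_tab12 (m : nat) : binsum (2 * m).+1 tab12 = 2 * 3 ^+ m.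
Proof. by rewrite (@binsum_eigen 3) 1?mulrC //; rewrite /tab12; tab_dec. Qed.

Lemma binsum_tab24 (m : nat) :
  binsum (2 * m).+1 tab24 = 4 * (S_ m.+1 + S_ m).
Proof.
rewrite binsum_S_; last by rewrite /tab24; tab_dec.
rewrite (binsumSS 1) !binsum1 [tab24 1]/(2) /=; ring.
Qed.

Lemma binsum_tab24' (m : nat) :
  binsum (2 * m).+1 tab24' = 2 * (S_ m.+1 - S_ m).
Proof.
rewrite binsum_S_; last by rewrite /tab24'; tab_dec.
by rewrite (binsumSS 1) !binsum1; ring.
Qed.

(* [(2 / p)] and [(3 / p)] as functions of the residue of [p]. *)
Definition sgn8 (p : nat) : int := if (p %% 8)%N \in [:: 1; 7] then 1 else -1.
Definition sgn12 (p : nat) : int := if (p %% 12)%N \in [:: 1; 11] then 1 else -1.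

(** * Values modulo p, and the sum over a residue class modulo 12 *)

Lemma mod24_cases (p : nat) : coprime 6 p ->
  (p %% 24)%N \in [:: 1; 5; 7; 11; 13; 17; 19; 23]%N.
Proof.
rewrite -(coprime_modr 6 p) -(@modn_dvdm 24) // coprime_modr.
by move: (p %% 24)%N (ltn_pmod p (isT : 0 < 24)%N); do 24! (case=> //).
Qed.

Lemma tab_at (p : nat) : coprime 6 p ->
  [/\ tab2 p%:Z = 2 * sgn8 p, tab2 (- p%:Z) = 2 * sgn8 p,
      tab24 p%:Z = 2 * sgn8 p & tab24 (- p%:Z) = 2 * sgn8 p] /\
  [/\ tab24' p%:Z = sgn8 p * sgn12 p, tab24' (- p%:Z) = sgn8 p * sgn12 p,
      tab12 p%:Z = sgn12 p & tab12 (- p%:Z) = sgn12 p].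
Proof.
move=> /mod24_cases; rewrite /sgn8 /sgn12.
rewrite -(@modn_dvdm 24 _ 8) // -(@modn_dvdm 24 _ 12) //.
have e a1 a3 a5 a7 a9 a11 : tab a1 a3 a5 a7 a9 a11 p%:Z
     = tab a1 a3 a5 a7 a9 a11 (p %% 24)%N%:Z by apply: tab_mod; lia.
have e' a1 a3 a5 a7 a9 a11 : tab a1 a3 a5 a7 a9 a11 (- p%:Z)
     = tab a1 a3 a5 a7 a9 a11 (- (p %% 24)%N%:Z) by apply: tab_mod; lia.
rewrite /tab2 /tab24 /tab24' /tab12 !e !e'.
by rewrite !inE => /or4P[/eqP->|/eqP->|/eqP->|/or4P[/eqP->|/eqP->|/eqP->|/orP[/eqP->|/eqP->]]].
Qed.

(** A Fourier expansion: 12 times the indicator of j = 3 or -3 modulo 24 if t = 1, and of j = 9 or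
    -9 if t = -1. For p prime to 6 and t = [sgn8 p] this is j = 3p or -3p. *)
Definition residue_fun (t : int) (j : int) : int :=
  2 * tab_ones j + -2 * tab3 j + (- t * tab2 j + t * tab24 j).

Lemma residue_funE (p k : nat) : coprime 6 p ->
  residue_fun (sgn8 p) (2 * k%:Z - p%:Z)
  = 12 * ((k %% 12 == (2 * p) %% 12)%N%:R + ((k + p) %% 12 == 0)%N%:R).
Proof.
move=> /mod24_cases pm.
pose r := (p %% 24)%N; pose i := (k %% 12)%N.
have -> : sgn8 p = sgn8 r by rewrite /sgn8 /r modn_dvdm.
have -> : ((2 * p) %% 12 = (2 * r) %% 12)%N by rewrite /r; lia.
have -> : ((k + p) %% 12 = (i + r) %% 12)%N by rewrite /r /i; lia.
have e a1 a3 a5 a7 a9 a11 : tab a1 a3 a5 a7 a9 a11 (2 * k%:Z - p%:Z)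
     = tab a1 a3 a5 a7 a9 a11 (2 * i%:Z - r%:Z) by apply: tab_mod; rewrite /r /i; lia.
rewrite /residue_fun /tab_ones /tab3 /tab2 /tab24 !e -/i.
have : r \in [:: 1; 5; 7; 11; 13; 17; 19; 23]%N by [].
have : (i < 12)%N by rewrite ltn_pmod.
move: i r {e pm} => i r i12 rm; apply/eqP.
have /allP/(_ r rm)/allP := (isT : all (fun r => all (fun i =>
  2 * tab 1 1 1 1 1 1 (2 * i%:Z - r%:Z) + -2 * tab 1 (-2) 1 1 (-2) 1 (2 * i%:Z - r%:Z) +
  (- sgn8 r * tab 2 (-2) (-2) 2 2 (-2) (2 * i%:Z - r%:Z) +
   sgn8 r * tab 2 4 (-2) 2 (-4) (-2) (2 * i%:Z - r%:Z)) ==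
  12 * ((i == (2 * r) %% 12)%N%:R + ((i + r) %% 12 == 0)%N%:R) :> int) (iota 0 12))
  [:: 1; 5; 7; 11; 13; 17; 19; 23]%N).
by apply; rewrite mem_iota.
Qed.

(** The reflection k -> p - k exchanges the classes of 2p and -p modulo 12 singled out by
    [residue_funE], hence 24 instead of 12. *)
Lemma binsum_residue (p : nat) : coprime 6 p ->
  binsum p (residue_fun (sgn8 p)) =
  24 * \sum_(0 <= k < p.+1 | (k %% 12 == (2 * p) %% 12)%N) ('C(p, k))%:Z.
Proof.
move=> c6; rewrite big_mkcond /=.
set A := \sum_(_ <= _ < _) _.
have A' : A = \sum_(0 <= k < p.+1) ('C(p, k))%:Z * ((k + p) %% 12 == 0)%N%:R.
  rewrite /A big_nat_rev /=; apply: eq_big_nat => k /andP[_ kp].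
  rewrite add0n subSS bin_sub //.
  have -> : ((p - k) %% 12 == (2 * p) %% 12)%N = ((k + p) %% 12 == 0)%N.
    by apply/eqP/eqP; lia.
  by case: eqP => _; rewrite ?mulr1 ?mulr0.
have -> : 24 * A = 12 * (A + A) by ring.
rewrite {2}A' /A -big_split mulr_sumr; apply: eq_bigr => k _ /=.
rewrite residue_funE //.
by do 2 case: (_ == _) => /=; ring.
Qed.

Lemma binsum_residue_fun (m : nat) (t : int) :
  binsum (2 * m).+1 (residue_fun t)
  = 2 * 2 ^+ (2 * m).+1 - 4 - t * (4 * 2 ^+ m) + t * (4 * (S_ m.+1 + S_ m)).
Proof.
rewrite /residue_fun !binsumD !binsumZ binsum_ones binsum_tab3 binsum_tab2 binsum_tab24.
by ring.
Qed.

(** Compares the closed forms of four table sums with their values from [binsum_prime], then cancels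
    powers of 2. *)
Lemma binsum_mod_p (p m : nat) : prime p -> coprime 6 p -> p = (2 * m).+1 ->
  [/\ (p%:Z %| 2 ^+ m - sgn8 p)%Z, (p%:Z %| S_ m.+1 + S_ m - sgn8 p)%Z,
      (p%:Z %| S_ m.+1 - S_ m - sgn8 p * sgn12 p)%Z & (p%:Z %| 3 ^+ m - sgn12 p)%Z].
Proof.
move=> pp c6 pm; have [[e1 e2 e3 e4] [e5 e6 e7 e8]] := tab_at _ c6.
have c2 : coprimez p 2 by rewrite coprimezE coprime_sym; move: c6; rewrite (@coprimeMl p 2 3) => /andP[].
have d2 x : (p%:Z %| 2 * x)%Z -> (p%:Z %| x)%Z by rewrite Gauss_dvdzr.
split.
- have := binsum_prime p tab2 pp; rewrite e1 e2 [in binsum _ _]pm binsum_tab2.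
  by rewrite (_ : _ - _ = 2 * (2 * (2 ^+ m - sgn8 p))); [move=> /d2/d2 | ring].
- have := binsum_prime p tab24 pp; rewrite e3 e4 [in binsum _ _]pm binsum_tab24.
  by rewrite (_ : _ - (_ + _) = 2 * (2 * (S_ m.+1 + S_ m - sgn8 p))); [move=> /d2/d2 | ring].
- have := binsum_prime p tab24' pp; rewrite e5 e6 [in binsum _ _]pm binsum_tab24'.
  by rewrite (_ : _ - (_ + _) = 2 * (S_ m.+1 - S_ m - sgn8 p * sgn12 p)); [move=> /d2 | ring].
- have := binsum_prime p tab12 pp; rewrite e7 e8 [in binsum _ _]pm binsum_tab12.
  by rewrite (_ : _ - _ = 2 * (3 ^+ m - sgn12 p)); [move=> /d2 | ring].
Qed.

(** * Identities for [S_] and the quadratic character of 3 *)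

(** The Lucas doubling U(2m) = U(m) V(m), with V(m) = 2 U(m+1) - 4 U(m); the odd case closes the
    induction. *)
Lemma S_double (m : nat) :
  S_ (2 * m)%N = S_ m * (2 * S_ m.+1 - 4 * S_ m)
  /\ S_ (2 * m).+1 = S_ m.+1 ^+ 2 - S_ m ^+ 2.
Proof.
elim: m => [|m [IH1 IH2]]; first by [].
have SS k : S_ k.+2 = 4 * S_ k.+1 - S_ k by [].
rewrite (_ : (2 * m.+1 = (2 * m).+2)%N); last by lia.
by rewrite (SS (2 * m).+1) !(SS (2 * m)%N) IH1 IH2 !(SS m); split; ring.
Qed.

(** The form x^2 - 4xy + y^2 is invariant under the recurrence step. *)
Lemma S_norm (m : nat) : S_ m.+1 ^+ 2 + S_ m ^+ 2 - 4 * S_ m * S_ m.+1 = 1.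
Proof.
elim: m => [|m IH] //; rewrite -[RHS]IH.
by rewrite (_ : S_ m.+2 = 4 * S_ m.+1 - S_ m) //; ring.
Qed.

(** By Fermat, a^m is 1 or -1 in ['F_p]. If it is 1, then a and the m distinct squares of 1, ..., m
    are roots of X^m - 1, so a is one of these squares. *)
Lemma euler_criterion (p m : nat) (a : int) : prime p -> p = (2 * m).+1 ->
  ~~ (p%:Z %| a)%Z -> (p%:Z %| a ^+ m - legendre a p)%Z.
Proof.
move=> pp pm pa; have p0 := prime_gt0 pp; have ch := pchar_Fp pp.
rewrite /legendre (negPf pa) (dvdz_pcharf ch) rmorphB rmorphXn /=.
have a0 : a%:~R != 0 :> 'F_p by rewrite -(dvdz_pcharf ch).
have fermat (x : 'F_p) : x != 0 -> (x ^+ 2) ^+ m = 1.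
  move=> x0; apply: (mulfI x0).
  have := expf_card x; rewrite card_Fp // => xp.
  by rewrite -exprM -exprS mulr1 -[RHS]xp; congr (_ ^+ _); exact: esym.
have FpE (x y : int) : (x == y %[mod p])%Z = (x%:~R == y%:~R :> 'F_p).
  by rewrite eqz_mod_dvd (dvdz_pcharf ch) rmorphB /= subr_eq0.
have m0 : (0 < m)%N by case: m pm pp {fermat} => // ->.
case: existsP => [[x]|nsq].
  rewrite FpE rmorphXn /= => /eqP xa; rewrite -xa subr_eq0 fermat //.
  by apply: contraNneq a0 => x0; rewrite -xa x0 expr0n.
have: (a%:~R ^+ m - 1) * (a%:~R ^+ m + 1) == 0 :> 'F_p.
  by rewrite -subr_sqr expr1n -exprM mulnC exprM fermat // subrr.
rewrite mulf_eq0 subr_eq0 rmorphN1 opprK => /orP[|//] am; case: nsq.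
pose sq (i : nat) : 'F_p := i%:R ^+ 2.
pose rs := a%:~R :: [seq sq i | i <- iota 1 m].
have X0 : 'X^m - 1 != 0 :> {poly 'F_p} by rewrite -size_poly_eq0 size_XnsubC.
have nat0 i : (0 < i < p)%N -> i%:R != 0 :> 'F_p.
  by move=> /andP[i0 ip]; rewrite -(dvdn_pcharf ch) gtnNdvd.
have rootrs : all (root ('X^m - 1)) rs.
  apply/andP; split; first by rewrite rootE !hornerE subr_eq0.
  apply/allP => _ /mapP[i + ->]; rewrite mem_iota => im.
  by rewrite rootE !hornerE /sq fermat ?subrr // nat0 //; lia.
have : ~~ uniq rs.
  apply/negP => /(max_poly_roots X0 rootrs).
  by rewrite size_XnsubC // /rs /= size_map size_iota ltnn.
rewrite /= map_inj_in_uniq ?iota_uniq ?andbT ?negbK; last first.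
  move=> i j; rewrite !mem_iota => im jm /eqP.
  wlog ij : i j im jm / (j <= i)%N.
    by move=> W; case/orP: (leq_total j i) => ij /eqP e; [|symmetry]; apply: W => //; rewrite e.
  (* Both indices are at most m, so i + j < p and only i = j remains. *)
  rewrite /sq -subr_eq0 subr_sqr mulf_eq0 -natrD -natrB // => /orP[|].
    rewrite -(dvdn_pcharf ch) => d; apply/eqP; rewrite eqn_leq ij andbT.
    by rewrite leqNgt; apply/negP => lt; move: d; rewrite gtnNdvd //; lia.
  by rewrite (negPf (nat0 _ _)) //; lia.
case/mapP => i; rewrite mem_iota => im ai.
have ip : (i < p)%N by lia.
by exists (Ordinal ip); rewrite FpE rmorphXn /= ai.
Qed.

(** Both sides are signs congruent to 3^m modulo p, and such signs coincide as p > 2. *)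
Lemma legendre3 (p : nat) : prime p -> (3 < p)%N -> legendre 3 p = sgn12 p.
Proof.
move=> pp p3.
have c6 := coprime6_prime _ pp p3.
have odd_p := odd_prime _ pp p3.
have pm : p = (2 * p./2).+1 by rewrite -[LHS]odd_double_half odd_p mul2n.
have np3 : ~~ (p%:Z %| 3)%Z by rewrite dvdzE /= gtnNdvd.
have [_ _ _ d] := binsum_mod_p _ _ pp c6 pm.
have := rpredB (euler_criterion _ _ _ pp pm np3) d.
rewrite (_ : _ - _ = sgn12 p - legendre 3 p); last by ring.
have le1 x y : x \in [:: 1; -1] -> y \in [:: 1; -1] -> (p%:Z %| x - y)%Z -> x = y :> int.
  rewrite !inE => /orP[]/eqP-> /orP[]/eqP-> //; rewrite dvdzE /= gtnNdvd //; lia.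
move=> e; apply/esym/le1 => //; first by rewrite /sgn12; case: ifP.
by rewrite /legendre (negPf np3); case: ifP.
Qed.

(** The index is 2m or 2(m+1), so [S_double] gives a quadratic expression in [S_ m] and [S_ m.+1],
    whose sum and difference are known modulo p. *)
Lemma S_prime_mod (p : nat) : prime p -> (3 < p)%N ->
  (6 * (legendre 3 p * S_ `|p%:Z - legendre 3 p|%N)
    - (4 * sgn8 p * (S_ p./2.+1 + S_ p./2) - 4))%:~R \in pideal p 2.
Proof.
move=> pp p3; set m := p./2; have p0 := prime_gt0 pp.
have c6 := coprime6_prime _ pp p3.
have odd_p := odd_prime _ pp p3.
have pm : p = (2 * m).+1 by rewrite -[LHS]odd_double_half odd_p mul2n.
have [_ dw dq _] := binsum_mod_p _ _ pp c6 pm.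
rewrite legendre3 //.
have iw := pideal_int _ _ p0 dw; have iq := pideal_int _ _ p0 dq.
set x := S_ m.+1 + S_ m - sgn8 p in iw; set y := S_ m.+1 - S_ m - sgn8 p * sgn12 p in iq.
(* The coefficients are such that the terms linear in [S_ m.+1 - S_ m] cancel; [S_norm] accounts for
   the constant. *)
have -> : 6 * (sgn12 p * S_ `|p%:Z - sgn12 p|%N) - (4 * sgn8 p * (S_ m.+1 + S_ m) - 4)
   = 12 * sgn12 p * (x * y) - 4 * (x * x) - 6 * (y * y).
  have N := S_norm m.
  apply/eqP; rewrite -subr_eq0; apply/eqP.
  transitivity (- 2 * (S_ m.+1 ^+ 2 + S_ m ^+ 2 - 4 * S_ m * S_ m.+1 - 1)); last by rewrite N.
  rewrite /x /y /sgn8 /sgn12; case: ifP => _; case: ifP => _.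
  - rewrite (_ : `|_|%N = 2 * m)%N; last by lia.
    by rewrite (S_double m).1; ring.
  - rewrite (_ : `|_|%N = 2 * m)%N; last by lia.
    by rewrite (S_double m).1; ring.
  - rewrite (_ : `|_|%N = 2 * m.+1)%N; last by lia.
    by rewrite (S_double m.+1).1 (_ : S_ m.+2 = 4 * S_ m.+1 - S_ m) //; ring.
  - rewrite (_ : `|_|%N = 2 * m.+1)%N; last by lia.
    by rewrite (S_double m.+1).1 (_ : S_ m.+2 = 4 * S_ m.+1 - S_ m) //; ring.
have pZ (c z : int) : z%:~R \in pideal p 2 -> (c * z)%:~R \in pideal p 2.
  by move=> zp; rewrite rmorphM pidealMl ?rpred_int.
have pM (z1 z2 : int) : z1%:~R \in pideal p 1 -> z2%:~R \in pideal p 1 ->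
    (z1 * z2)%:~R \in pideal p 2.
  by move=> z1p z2p; rewrite rmorphM (pidealM _ 1 1).
by rewrite !rmorphB !rpredB //; apply: pZ; apply: pM.
Qed.

(** * Assembly of the congruence modulo p^2 *)

Theorem theorem3p3 (p : nat) (p_prime : prime p) (p_gt3 : (3 < p)%N) :
  prat_congr p (p ^ 2)
    (\sum_(0 <= k < (p.-1)./2.+1)
       ('C(3 * k, k) * 'C(6 * k, 3 * k))%:R / 432%:R ^+ k)
    ((-1) ^+ (p.-1)./2
     * (1 + (legendre 3 p * S_ `|p%:Z - legendre 3 p|%N)%:~R)).
Proof.
have p0 := prime_gt0 p_prime.
have c6' := coprime6_prime _ p_prime p_gt3.
have c6 : coprime p 6 by rewrite coprime_sym.
have odd_p := odd_prime _ p_prime p_gt3.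
have -> : (p.-1./2 = p./2)%N by lia.
set m := p./2; set t := (p %/ 6)%N.
have pm : p = (2 * m).+1 by rewrite -[LHS]odd_double_half odd_p mul2n.
have p6 : (p %% 6 = 1 \/ p %% 6 = 5)%N.
  have p3 : ~~ (3 %| p)%N by rewrite dvdn_prime2 // neq_ltn p_gt3.
  by move: p3 odd_p; rewrite /dvdn; lia.
have tp : (6 * t < p)%N by rewrite /t; lia.
rewrite binom_sumE.
(* t - p/6 is -1/6 if p = 1 modulo 6, and -5/6 = -1 - (-1/6) if p = 5 modulo 6. *)
have -> : hyp_sum m (-1 / 6%:R) = hyp_sum m (t%:R - p%:R / 6%:R).
  have pE := divn_eq p 6.
  case: p6 => r; rewrite r in pE; last rewrite -hyp_sumC; congr (hyp_sum _ _);
    by rewrite pE natrD natrM -/t; field.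
(* m is 3t or 3t + 2, so it has the parity of t. *)
have sgnE : (-1) ^+ t = (-1) ^+ m :> rat.
  by rewrite -signr_odd -[RHS]signr_odd; congr (_ ^+ _); rewrite /t /m; case: p6; lia.
have H := @hyp_sum_mod p m t p_prime p_gt3 pm tp; rewrite sgnE in H.
set ES := legendre 3 p * _.
pose D := p%:R / 6%:R * (harm m - 2 * alt_harm t) - ES%:~R.
have DP : D \in pideal p 2.
  have h1 := @harm_half_mod p m p_prime pm.
  have h2 := @alt_harm_sixth_mod p p_prime p_gt3.
  have h3 := @S_prime_mod p p_prime p_gt3.
  have [/(pideal_int _ _ p0) d2 _ _ _] := binsum_mod_p _ _ p_prime c6' pm.
  have h4 := pidealM _ 1 1 _ _ d2 d2.
  move: h2; rewrite -/t; set A := \sum_(_ <= _ < _ | _) _ => h2.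
  pose w := S_ m.+1 + S_ m; pose e : rat := (sgn8 p)%:~R.
  have hA : 24 * A = 2 * 2 ^+ p - 4 - e * (4 * 2 ^+ m) + e * (4 * w%:~R).
    transitivity ((2 * 2 ^+ p - 4 - sgn8 p * (4 * 2 ^+ m) + sgn8 p * (4 * w))%:~R : rat).
      have := binsum_residue _ c6'; rewrite [in LHS]pm binsum_residue_fun -pm => ->.
      by rewrite intrM rmorph_sum.
    by rewrite intrD !intrB !intrM !rmorphXn.
  have e2 : e ^+ 2 = 1 by rewrite /e -rmorphXn /sgn8; case: ifP.
  have p2 : 2 ^+ p = 2 * (2 ^+ m) ^+ 2 :> rat by rewrite pm exprS mulnC exprM.
  (* After [hA], the powers of 2 combine into 2 (2^m - [sgn8 p])^2, which vanishes modulo p^2; what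
     remains is [4 * sgn8 p * w - 4], matched by [S_prime_mod]. *)
  have -> : D = ((p%:R * harm m - (2 - 2 ^+ p)) - 2 * (p%:R * alt_harm t + 12 * A)
     + 2 * ((2 ^+ m - sgn8 p)%:~R * (2 ^+ m - sgn8 p)%:~R)
     - (6 * ES - (4 * sgn8 p * w - 4))%:~R) / 6%:R.
    rewrite !intrB (intrM _ 6 ES) (intrM _ _ w) (intrM _ 4) rmorphXn -/e.
    have -> : 2 * (p%:R * alt_harm t + 12 * A) = 2 * (p%:R * alt_harm t) + 24 * A by ring.
    rewrite hA p2 /D; move: (2 ^+ m) => v.
    apply/eqP; rewrite -subr_eq0; apply/eqP.
    transitivity ((1 - e ^+ 2) / 3%:R); first by field.
    by rewrite e2 subrr mul0r.
  apply: pidealMr; last exact: prat_natV.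
  apply: rpredB; last exact: h3.
  apply: rpredD; last by apply: pidealMl => //; exact: rpred_nat.
  apply: rpredB => //; apply: pidealMl => //; exact: rpred_nat.
have main : hyp_sum m (t%:R - p%:R / 6%:R) - (-1) ^+ m * (1 + ES%:~R) \in pideal p 2.
  have -> : hyp_sum m (t%:R - p%:R / 6%:R) - (-1) ^+ m * (1 + ES%:~R) =
    (hyp_sum m (t%:R - p%:R / 6%:R)
     - (-1) ^+ m * (1 + p%:R / 6%:R * (harm m - 2 * alt_harm t))) + (-1) ^+ m * D.
    by rewrite /D; ring.
  by apply: rpredD => //; apply: pidealMl => //; rewrite rpredX // rpredN1.
have R : (-1) ^+ m * (1 + ES%:~R) \in prat p.
  by rewrite rpredM ?rpredX ?rpredN1 // rpredD ?rpred1 ?rpred_int.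
split => //.
  rewrite -[X in prat p X](subrK ((-1) ^+ m * (1 + ES%:~R))).
  by apply: rpredD => //; rewrite -pideal0 pidealW // pidealW.
exists ((hyp_sum m (t%:R - p%:R / 6%:R) - (-1) ^+ m * (1 + ES%:~R)) / p%:R ^+ 2).
  exact: main.
by rewrite natrX [RHS]mulrC divfK // expf_neq0 // pnatr_eq0 -lt0n.
Qed.
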